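(* Let $\{\varepsilon_k\}\subseteq[0,\infty)$ be a null sequence, and let $\{(x^k,\mu^k,\lambda^k)\}$ be a primal-dual sequence generated by the elastically safeguarded augmented Lagrangian algorithm (described in the context) applied to (NLP) such that $\|\nabla_x\mathcal L_{\upsilon_k}(x^k,\hat\mu^k,\hat\lambda^k)\|\le\varepsilon_k$ holds for each $k\in\mathbb N$. Let $\bar x\in\mathbb R^n$ be an accumulation point of $\{x^k\}$ where extended strong quasinormality is valid. Let $K\subseteq\mathbb N$ be an infinite index set such that the subsequence $\{x^k\}_{k\in K}$ converges to $\bar x$, and assume that for each infinite index set $L\subseteq K$ the following two conditions hold: 1. for each $i\in\{1,\dots,m\}$, whenever $\mu^k_i\to+\infty$ as $k\to\infty$ along $L$, then there is an infinite index set $L_i\subseteq K$ such that $g_i(x^k)>0$ for all $k\in L_i$; 2. for each $j\in\{1,\dots,\ell\}$, whenever $\lambda^k_j\to+\infty$ or $\lambda^k_j\to-\infty$ as $k\to\infty$ along $L$, then there is an infinite index set $L_j\subseteq L$ such that $\lambda^k_j\,h_j(x^k)>0$ for all $k\in L_j$. Then $\{(\mu^k,\lambda^k)\}_{k\in K}$ is bounded. Furthermore, $\bar x$ is stationary for (NLP), and each accumulation point $(\mu,\lambda)$ of $\{(\mu^k,\lambda^k)\}_{k\in K}$ is a multiplier certifying stationarity of $\bar x$.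
   Context: Problem (NLP): minimize $f(x)$ subject to $g(x)\le 0$, $h(x)=0$, where $f\colon\mathbb R^n\to\mathbb R$, $g\colon\mathbb R^n\to\mathbb R^m$, $h\colon\mathbb R^n\to\mathbb R^\ell$ are continuously differentiable. $\|\cdot\|$ is the Euclidean norm; $\max,\min$ of vectors are componentwise; $\mathbb N$ includes $0$; $g'(x)$, $h'(x)$ denote Jacobians. Lagrangian: $L(x,\mu,\lambda)=f(x)+\langle\mu,g(x)\rangle+\langle\lambda,h(x)\rangle$. Augmented Lagrangian for $\upsilon>0$: $\mathcal L_\upsilon(x,\mu,\lambda)=f(x)+\frac1{2\upsilon}\|\max\{0,g(x)+\upsilon\mu\}\|^2+\frac1{2\upsilon}\|h(x)+\upsilon\lambda\|^2$. Elastically safeguarded augmented Lagrangian algorithm. Data: $\upsilon_0>0$; nonempty compact sets $Y^g\subseteq\mathbb R^m$, $Y^h\subseteq\mathbb R^\ell$; $\tau,\gamma\in(0,1)$; $\eta\in(\gamma,\sqrt\gamma)$; tolerances $\varepsilon_k\ge0$. Set $V_{-1}=+\infty$, $\varrho_0=1$. For $k=0,1,2,\dots$ (no termination): (1) select any $\hat\mu^k\in\varrho_kY^g$ and $\hat\lambda^k\in\varrho_kY^h$; (2) find $x^k\in\mathbb R^n$, an $\varepsilon_k$-approximate solution of minimizing $\mathcal L_{\upsilon_k}(\cdot,\hat\mu^k,\hat\lambda^k)$ over $\mathbb R^n$ (the precise sense is the one specified in the claim); (3) set $z^k=\min\{0,g(x^k)+\upsilon_k\hat\mu^k\}$ and $V_k=\max\{\|g(x^k)-z^k\|,\|h(x^k)\|\}$;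 (4) set $\mu^k=\hat\mu^k+[g(x^k)-z^k]/\upsilon_k$ and $\lambda^k=\hat\lambda^k+h(x^k)/\upsilon_k$; (5) if $V_k\le\tau V_{k-1}$, set $\upsilon_{k+1}=\upsilon_k$, $\varrho_{k+1}=\varrho_k$; otherwise set $\upsilon_{k+1}=\gamma\upsilon_k$, $\varrho_{k+1}=\eta\varrho_k/\gamma$. Stationarity: a feasible point $x$ of (NLP) is stationary if there exist $\mu\in\mathbb R^m$, $\lambda\in\mathbb R^\ell$ with $\nabla_xL(x,\mu,\lambda)=0$, $\mu\ge0$, $\mu^\top g(x)=0$; such $(\mu,\lambda)$ is called a multiplier certifying stationarity of $x$. Extended strong quasinormality holds at a (not necessarily feasible) point $\bar x\in\mathbb R^n$ if there do not exist $(\mu,\lambda)\in\mathbb R^m\times\mathbb R^\ell$ with $(\mu,\lambda)\neq(0,0)$ and, for each $i\in\{1,\dots,m\}$ with $\mu_i\ne0$ and each $j\in\{1,\dots,\ell\}$ with $\lambda_j\neq0$, sequences $\{y^{i,k}\}_k\subseteq\mathbb R^n$ and $\{z^{j,k}\}_k\subseteq\mathbb R^n$ such that $y^{i,k}\to\bar x$ and $z^{j,k}\to\bar x$ as $k\to+\infty$, $g_i(y^{i,k})>0$ and $\lambda_j h_j(z^{j,k})>0$ for all $k\in\mathbb N$, and $g'(\bar x)^\top\mu+h'(\bar x)^\top\lambda=0$, $\mu\ge0$, $\mu^\top\min\{0,g(\bar x)\}=0$. *)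

(* Defs.v *)
(* Vectors of R^n are row vectors 'rV[R]_n over an arbitrary R : realType. *)
From HB Require Import structures.
From mathcomp Require Export all_boot all_order all_algebra.
From mathcomp Require Export all_classical all_reals all_analysis.

Set Implicit Arguments.
Unset Strict Implicit.
Unset Printing Implicit Defensive.

Export Order.TTheory GRing.Theory Num.Theory.
Export numFieldNormedType.Exports.

Local Open Scope classical_set_scope.
Local Open Scope ring_scope.

Section Vectors.
Context {R : realType} {n m : nat}.

Definition dotp (u v : 'rV[R]_n) : R := \sum_i u 0 i * v 0 i.

(* The norm `|v| of the library on 'rV[R]_n is the maximum norm. *)
Definition enorm (v : 'rV[R]_n) : R := Num.sqrt (dotp v v).

Definition max0 (v : 'rV[R]_n) : 'rV[R]_n := map_mx (Num.max 0) v.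
Definition min0 (v : 'rV[R]_n) : 'rV[R]_n := map_mx (Num.min 0) v.

Definition grad (F : 'rV[R]_n -> R) (x : 'rV[R]_n) : 'rV[R]_n :=
  \row_i 'D_(delta_mx 0 i) F x.

Definition C1_fun (F : 'rV[R]_n -> R) : Prop :=
  (forall x, differentiable F x) /\ continuous (grad F).

Definition C1_map (F : 'rV[R]_n -> 'rV[R]_m) : Prop :=
  (forall x, differentiable F x) /\ continuous (jacobian F).

(* Since the library's 'J F x acts on row vectors from the right, its entry
   (i, j) is the i-th partial derivative of F_j, so the row vector below is the
   transpose of the column F'(x)^T mu. *)
Definition jacT_mul (F : 'rV[R]_n -> 'rV[R]_m) (x : 'rV[R]_n)
    (mu : 'rV[R]_m) : 'rV[R]_n := mu *m ('J F x)^T.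

End Vectors.

Section NLP.
Context {R : realType} {n m l : nat}.
Variables (f : 'rV[R]_n -> R) (g : 'rV[R]_n -> 'rV[R]_m)
  (h : 'rV[R]_n -> 'rV[R]_l).

Definition lagrangian (x : 'rV[R]_n) (mu : 'rV[R]_m) (lam : 'rV[R]_l) : R :=
  f x + dotp mu (g x) + dotp lam (h x).

Definition aug_lagrangian (upsilon : R) (x : 'rV[R]_n) (mu : 'rV[R]_m)
    (lam : 'rV[R]_l) : R :=
  f x + (2 * upsilon)^-1 * enorm (max0 (g x + upsilon *: mu)) ^+ 2
      + (2 * upsilon)^-1 * enorm (h x + upsilon *: lam) ^+ 2.

Definition feasible (x : 'rV[R]_n) : Prop :=
  (forall i, g x 0 i <= 0) /\ h x = 0.

Definition certifies_stationarity (x : 'rV[R]_n) (mu : 'rV[R]_m)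
    (lam : 'rV[R]_l) : Prop :=
  [/\ grad (fun y => lagrangian y mu lam) x = 0,
      forall i, 0 <= mu 0 i
    & dotp mu (g x) = 0].

Definition stationary (x : 'rV[R]_n) : Prop :=
  feasible x /\ exists mu lam, certifies_stationarity x mu lam.

Definition extended_strong_quasinormality (xbar : 'rV[R]_n) : Prop :=
  ~ exists (mu : 'rV[R]_m) (lam : 'rV[R]_l),
    [/\ (mu, lam) <> (0, 0),
        forall i, mu 0 i != 0 -> exists y : nat -> 'rV[R]_n,
          y @ \oo --> xbar /\ forall k, 0 < g (y k) 0 i,
        forall j, lam 0 j != 0 -> exists z : nat -> 'rV[R]_n,
          z @ \oo --> xbar /\ forall k, 0 < lam 0 j * h (z k) 0 j
      & [/\ jacT_mul g xbar mu + jacT_mul h xbar lam = 0,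
            forall i, 0 <= mu 0 i
          & dotp mu (min0 (g xbar)) = 0]].

Record esal_data (upsilon0 : R) (Yg : set 'rV[R]_m) (Yh : set 'rV[R]_l)
    (tau gamma eta : R) : Prop := EsalData {
  esal_upsilon0_gt0 : 0 < upsilon0;
  esal_Yg_nonempty : Yg !=set0;
  esal_Yg_compact : compact Yg;
  esal_Yh_nonempty : Yh !=set0;
  esal_Yh_compact : compact Yh;
  esal_tau : 0 < tau < 1;
  esal_gamma : 0 < gamma < 1;
  esal_eta : gamma < eta < Num.sqrt gamma }.

(* V_{k-1}, with the convention V_{-1} = +oo. *)
Definition prev_V (V : nat -> R) (k : nat) : \bar R :=
  if k is j.+1 then (V j)%:E else +oo%E.

(* The sequences upsilon, rho, ..., lam obey every rule of the algorithm except
   the choice of x k as an approximate minimizer of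
   the augmented Lagrangian for upsilon k, muhat k and lamhat k, whose precise sense
   depends on the result at hand and has to be required separately. *)
Record esal_sequence (upsilon0 : R) (Yg : set 'rV[R]_m) (Yh : set 'rV[R]_l)
    (tau gamma eta : R) (upsilon rho : nat -> R)
    (muhat : nat -> 'rV[R]_m) (lamhat : nat -> 'rV[R]_l)
    (x : nat -> 'rV[R]_n) (z : nat -> 'rV[R]_m) (V : nat -> R)
    (mu : nat -> 'rV[R]_m) (lam : nat -> 'rV[R]_l) : Prop := EsalSequence {
  esal_upsilon_init : upsilon 0%N = upsilon0;
  esal_rho_init : rho 0%N = 1;
  esal_muhat : forall k, [set rho k *: y | y in Yg] (muhat k);
  esal_lamhat : forall k, [set rho k *: y | y in Yh] (lamhat k);
  esal_z : forall k, z k = min0 (g (x k) + upsilon k *: muhat k);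
  esal_V : forall k, V k = Num.max (enorm (g (x k) - z k)) (enorm (h (x k)));
  esal_mu : forall k, mu k = muhat k + (upsilon k)^-1 *: (g (x k) - z k);
  esal_lam : forall k, lam k = lamhat k + (upsilon k)^-1 *: h (x k);
  esal_update : forall k,
    if ((V k)%:E <= tau%:E * prev_V V k)%E
    then upsilon k.+1 = upsilon k /\ rho k.+1 = rho k
    else upsilon k.+1 = gamma * upsilon k /\ rho k.+1 = eta * rho k / gamma }.

End NLP.

(* Main.v *)
(* The gradient of the augmented Lagrangian at x^k is the gradient of the
   Lagrangian at (x^k, mu^k, lam^k), so the latter tends to 0.  The algorithm
   has two regimes: either the test on V_k eventually always succeeds, so that
   V_k tends to 0 while upsilon_k and rho_k become constant, or upsilon_k and
   upsilon_k rho_k (which shrinks by the factor eta < 1 at each failure) tend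
   to 0, hence so do upsilon_k muhat^k and upsilon_k lamhat^k.

   If the multipliers were unbounded along K, only the second regime would be
   possible, and a limit direction of the normalized multipliers would
   contradict extended strong quasinormality: the gradient of f is scaled away,
   mu_i^k = 0 eventually where g_i(xbar) < 0, and the sequences required for
   the nonzero components are subsequences of x^k supplied by the two
   conditions on K.

   Along a subsequence with convergent multipliers, g(x^k) - z^k and h(x^k)
   tend to 0 in both regimes, which gives feasibility of xbar; complementarity
   holds because mu_i^k > 0 forces z_i^k = 0. *)
Require Import Defs.
From mathcomp Require Import ring lra.

Set Implicit Arguments.
Unset Strict Implicit.
Unset Printing Implicit Defensive.

Local Open Scope classical_set_scope.
Local Open Scope ring_scope.

(** * Differentiability of the penalty terms *)

Section Calculus.
Context {R : realType}.

(** The squared positive part is convex with the 2-Lipschitz derivative [2 * Num.max 0 t], so its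
    first-order remainder lies between 0 and [d ^+ 2]. *)
Lemma sqr_max0_taylor (t d : R) :
  0 <= Num.max 0 (t + d) ^+ 2 - Num.max 0 t ^+ 2 - 2 * Num.max 0 t * d <= d ^+ 2.
Proof. by case: (leP 0 t) => ?; case: (leP 0 (t + d)) => ?; nra. Qed.

Lemma is_derive_sqr_max0 (t : R) :
  is_derive t 1 (fun s : R => Num.max 0 s ^+ 2) (2 * Num.max 0 t).
Proof.
suff q : (fun d : R => d^-1 *: (Num.max 0 (d *: 1 + t) ^+ 2 - Num.max 0 t ^+ 2))
    @ 0^' --> 2 * Num.max 0 t.
  by apply: DeriveDef; [apply/cvg_ex; eexists; exact: q | exact: cvg_lim].
apply/cvgrPdist_le => e e0; near=> d.
have d0 : d != 0 by near: d; exact: nbhs_dnbhs_neq.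
have /andP[lo hi] := sqr_max0_taylor t d.
rewrite [d *: 1]mulr1 [d + t]addrC distrC.
set a := Num.max 0 (t + d) ^+ 2 in lo hi *.
have -> : d^-1 *: (a - Num.max 0 t ^+ 2) - 2 * Num.max 0 t
        = d^-1 * (a - Num.max 0 t ^+ 2 - 2 * Num.max 0 t * d).
  by rewrite mulrBr mulrCA mulVf // mulr1.
(* The error of the difference quotient is the first-order remainder divided by [d]; this also
   covers the kink at [t = 0]. *)
apply: (@le_trans _ _ `|d|).
  rewrite normrM (ger0_norm lo) normfV ler_pdivrMl ?normr_gt0 //.
  by rewrite -expr2 real_normK ?num_real.
by near: d; exact: dnbhs0_le.
Unshelve. all: by end_near. Qed.

Lemma is_derive_comp1 (V : normedModType R) (phi : R -> R) (F : V -> R)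
    (x v : V) (dphi : R) :
  is_derive (F x) 1 phi dphi -> differentiable F x ->
  is_derive x v (phi \o F) (dphi * 'D_v F x).
Proof.
move=> dphiF dF; have dfp : differentiable phi (F x) by apply/derivable1_diffP.
have dc : differentiable (phi \o F) x by exact: differentiable_comp.
apply: DeriveDef; first exact: diff_derivable.
rewrite (deriveE _ dc) (deriveE _ dF) diff_comp //= diff1E // derive1E derive_val.
by rewrite mulrC.
Qed.

Section Partial.
Context {n : nat}.
Implicit Types x : 'rV[R]_n.

Lemma is_derive_partial_coord m (G : 'rV[R]_n -> 'rV[R]_m) x i j :
  differentiable G x ->
  is_derive x (delta_mx 0 i) (fun y => G y 0 j) ('J G x i j).
Proof.
move=> dG; have dGi := diff_derivable (v := delta_mx 0 i) dG.
apply: DeriveDef; first exact: (derivable_mxP _ _ _).1 dGi 0 j.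
have := congr1 (fun M : 'rV_m => M 0 j) (derive_mx dGi).
by rewrite deriveEjacobian // -rowE !mxE => ->.
Qed.

Lemma jacT_mulE m (G : 'rV[R]_n -> 'rV[R]_m) x mu i :
  jacT_mul G x mu 0 i = \sum_j mu 0 j * 'J G x i j.
Proof. by rewrite mxE; apply: eq_bigr => j _; rewrite [_^T _ _]mxE. Qed.

Lemma is_derive_dotp m (G : 'rV[R]_n -> 'rV[R]_m) x mu i :
  differentiable G x ->
  is_derive x (delta_mx 0 i) (fun y => dotp mu (G y)) (jacT_mul G x mu 0 i).
Proof.
move=> dG; rewrite jacT_mulE.
rewrite (_ : (fun y => _) = \sum_j (mu 0 j *: (fun y => G y 0 j))); last first.
  by apply/funext => y; rewrite fct_sumE.
by apply: is_derive_sum => j; apply: is_deriveZ; exact: is_derive_partial_coord.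
Qed.

Lemma enorm_sqr m (v : 'rV[R]_m) : enorm v ^+ 2 = \sum_j v 0 j ^+ 2.
Proof.
by rewrite sqr_sqrtr; [|apply: sumr_ge0 => j _; rewrite -expr2 sqr_ge0].
Qed.

Lemma coord_le_enorm m (v : 'rV[R]_m) j : `|v 0 j| <= enorm v.
Proof.
rewrite -sqrtr_sqr ler_sqrt.
  by rewrite /dotp (bigD1 j) //= -expr2 lerDl sumr_ge0 // => i _; rewrite -expr2 sqr_ge0.
by apply: sumr_ge0 => i _; rewrite -expr2 sqr_ge0.
Qed.

(* Meant for phi t = t ^+ 2 and phi t = (max 0 t) ^+ 2, the two penalty terms. *)
Lemma is_derive_penalty m (phi : R -> R) (dphi : R -> R) (c : 'rV[R]_m) (ups : R)
    (G : 'rV[R]_n -> 'rV[R]_m) x i :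
  0 < ups -> (forall t : R, is_derive t 1 phi (2 * dphi t)) -> differentiable G x ->
  is_derive x (delta_mx 0 i)
    (fun y => (2 * ups)^-1 * \sum_j phi ((G y + c) 0 j))
    (jacT_mul G x (ups^-1 *: map_mx dphi (G x + c)) 0 i).
Proof.
move=> ups0 dphiP dG; rewrite jacT_mulE.
rewrite (_ : (fun y => _) =
    (2 * ups)^-1 *: \sum_j (phi \o (fun y => (G y + c) 0 j))); last first.
  by apply/funext => y; rewrite /GRing.scale /= fct_sumE.
have dGc : differentiable (fun y => G y + c) x by exact: differentiableD.
have JE j : is_derive x (delta_mx 0 i) (fun y => (G y + c) 0 j) ('J G x i j).
  rewrite (_ : (fun y => _) = (fun y => G y 0 j) + cst (c 0 j)); last first.
    by apply/funext => y; rewrite mxE.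
  rewrite -[X in is_derive _ _ _ X]addr0.
  by apply: is_deriveD; exact: is_derive_partial_coord.
apply: is_derive_eq.
  apply: is_deriveZ; apply: is_derive_sum => j.
  by apply: is_derive_comp1; exact: (differentiable_comp dGc (differentiable_coord _ _ _)).
rewrite /GRing.scale /= mulr_sumr; apply: eq_bigr => j _.
(* The 2 in the derivative [2 * dphi] cancels the one in [(2 * ups)^-1]. *)
rewrite (@derive_val _ _ _ _ _ _ _ (JE j)) !mxE; field.
by rewrite gt_eqF.
Qed.

End Partial.

End Calculus.

(** * Gradients of the Lagrangian and the augmented Lagrangian *)

Section Gradients.
Context {R : realType} {n m l : nat}.
Variables (f : 'rV[R]_n -> R) (g : 'rV[R]_n -> 'rV[R]_m) (h : 'rV[R]_n -> 'rV[R]_l).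

Lemma grad_lagrangian x mu lam :
  differentiable f x -> differentiable g x -> differentiable h x ->
  grad (fun y => lagrangian f g h y mu lam) x =
  grad f x + jacT_mul g x mu + jacT_mul h x lam.
Proof.
move=> df dg dh; apply/rowP => i.
rewrite [LHS]mxE [RHS]mxE [X in _ = X + _]mxE [X in _ = X + _ + _]mxE.
have dfi := derivableP (diff_derivable (v := delta_mx 0 i) df).
have dgi := is_derive_dotp mu i dg; have dhi := is_derive_dotp lam i dh.
exact: (@derive_val _ _ _ _ _ _ _ (is_deriveD (is_deriveD dfi dgi) dhi)).
Qed.

(** The two vectors to which the transposed Jacobians are applied are the updated multipliers of the
    algorithm, by [mu_max0] and [lam_scaled] below. *)
Lemma grad_aug_lagrangian ups x muhat lamhat : 0 < ups ->
  differentiable f x -> differentiable g x -> differentiable h x ->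
  grad (fun y => aug_lagrangian f g h ups y muhat lamhat) x =
  grad f x + jacT_mul g x (ups^-1 *: max0 (g x + ups *: muhat))
           + jacT_mul h x (ups^-1 *: (h x + ups *: lamhat)).
Proof.
move=> ups0 df dg dh.
have -> : (fun y => aug_lagrangian f g h ups y muhat lamhat) =
    f + (fun y => (2 * ups)^-1 * \sum_j Num.max 0 ((g y + ups *: muhat) 0 j) ^+ 2)
      + (fun y => (2 * ups)^-1 * \sum_j (h y + ups *: lamhat) 0 j ^+ 2).
  apply/funext => y; rewrite /aug_lagrangian !enorm_sqr; congr (_ + _ * _ + _).
  by apply: eq_bigr => j _; rewrite [max0 _ _ _]mxE.
apply/rowP => i.
rewrite [LHS]mxE [RHS]mxE [X in _ = X + _]mxE [X in _ = X + _ + _]mxE.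
have dfi := derivableP (diff_derivable (v := delta_mx 0 i) df).
have dgi := is_derive_penalty (ups *: muhat) i ups0 is_derive_sqr_max0 dg.
have dsqr (t : R) : is_derive t 1 (fun s : R => s ^+ 2) (2 * id t).
  by apply: is_derive_eq; rewrite /GRing.scale /=; ring.
have dhi := is_derive_penalty (ups *: lamhat) i ups0 dsqr dh.
have := @derive_val _ _ _ _ _ _ _ (is_deriveD (is_deriveD dfi dgi) dhi).
by rewrite [map_mx id _]map_mx_id.
Qed.

End Gradients.

(** * Subsequences along an index set *)

Section Subsequences.

Lemma infinite_natP (K : set nat) :
  infinite_set K <-> forall N, exists2 k, (N <= k)%N & K k.
Proof.
split=> [Kinf N|Kub /finite_seqP[s Ks]].
  apply: contra_notP Kinf => nK; apply: (@sub_finite_set _ _ `I_N); last exact: finite_II.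
  by move=> k Kk /=; rewrite ltnNge; apply/negP => Nk; apply: nK; exists k.
have [k + Kk] := Kub (\max_(i <- s) i).+1.
by rewrite ltnNge leq_bigmax_seq //; move: Kk; rewrite Ks.
Qed.

(** Subsequences are encoded by maps with [N <= s N] instead of strictly increasing ones: this
    already sends [s] to infinity and is stable under composition. *)
Lemma cvg_subseq (K : set nat) (s : nat -> nat) :
  (forall N, (N <= s N)%N /\ K (s N)) -> s @ \oo --> within K \oo.
Proof.
move=> sK A [M _ MA]; exists M => // N /= MN.
by have [Ns KsN] := sK N; apply: MA => //=; exact: leq_trans MN Ns.
Qed.

Lemma infinite_range (s : nat -> nat) :
  (forall N, (N <= s N)%N) -> infinite_set (range s).
Proof. by move=> sN; apply/infinite_natP => N; exists (s N) => //; exists N. Qed.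

(** An index [s N] larger than all of [s 0], ..., [s (M - 1)] has [N >= M], so neither monotonicity
    nor injectivity of [s] enters. *)
Lemma cvg_within_range (T : Type) (u : nat -> T) (s : nat -> nat) (F : set_system T) :
  u \o s @ \oo --> F -> u @ within (range s) \oo --> F.
Proof.
move=> usF A /usF[M _ MA]; exists (\max_(i < M) s i).+1 => // k /= sk [N _ sNk].
rewrite -sNk in sk *; apply: MA => /=; rewrite leqNgt; apply/negP => NM.
by move: sk; rewrite ltnNge (leq_bigmax (Ordinal NM)).
Qed.

(** Clustering along [within K \oo] provides, for each [N], an index in [K] beyond [N] whose value
    lies within [1 / (N + 1)] of [p]. *)
Lemma cluster_subseq (R : realType) (T : pseudoMetricType R) (u : nat -> T)
    (K : set nat) (p : T) : cluster (u @ within K \oo) p ->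
  exists s : nat -> nat, (forall N, (N <= s N)%N /\ K (s N)) /\ u \o s @ \oo --> p.
Proof.
move=> clu; have /choice[s sP] (N : nat) :
    exists k, ((N <= k)%N /\ K k) /\ ball p (N.+1%:R^-1 : R) (u k).
  have uF : (u @ within K \oo) (u @` [set k | (N <= k)%N /\ K k]).
    by exists N => // k /= Nk Kk; exists k.
  have N0 : 0 < (N.+1%:R^-1 : R) by [].
  have [_ [[k [Nk Kk] <-] puk]] := clu _ _ uF (nbhsx_ballx p _ N0).
  by exists k.
exists s; split=> [N|]; first exact: (sP N).1.
apply/cvg_ballP => e e0; near=> N; apply: le_ball (sP N).2.
by apply: ltW; near: N; exact: near_infty_natSinv_lt (PosNum e0).
Unshelve. all: by end_near. Qed.

Lemma compact_subseq (R : realType) (T : pseudoMetricType R) (A : set T) (u : nat -> T) :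
  compact A -> (forall N, A (u N)) ->
  exists (s : nat -> nat) (p : T), (forall N, (N <= s N)%N) /\ u \o s @ \oo --> p.
Proof.
move=> cA Au; have [|p [_ up]] := cA (u @ \oo) (fmap_proper_filter _ _).
  by exists 0%N => // N _; exact: Au.
have [|s [sN us]] := @cluster_subseq R T u setT p; first by rewrite withinET.
by exists s, p; split=> // N; exact: (sN N).1.
Qed.

End Subsequences.

(** * Limits of real sequences and of vectors *)

Section Reals.
Context {R : realType}.

(** If the limit were positive, eventually [a k] would be below the limit divided by [c], and the
    next contraction would push [a k.+1] below the limit. This serves [V], [upsilon] and
    [upsilon * rho] alike. *)
Lemma nonincreasing_contracting_cvg0 (a : nat -> R) (c : R) :
  0 < c < 1 -> (forall k, 0 <= a k) -> (forall k, a k.+1 <= a k) ->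
  (forall N, exists2 k, (N <= k)%N & a k.+1 <= c * a k) -> a @ \oo --> (0 : R).
Proof.
move=> /andP[c0 c1] a0 amono aio.
have adec : nonincreasing_seq a by apply/nonincreasing_seqP.
have acvg : cvgn a by apply: nonincreasing_is_cvgn => //; exists 0 => _ [k _ <-].
have la k : lim (a @ \oo) <= a k by exact: nonincreasing_cvgn_ge.
have l0 : 0 <= lim (a @ \oo) by apply: limr_ge => //; exact: nearW.
suff le0 : lim (a @ \oo) <= 0.
  by have <- : lim (a @ \oo) = 0 by apply/eqP; rewrite eq_le le0.
rewrite leNgt; apply/negP => lgt0.
have [N _ NP] : \forall k \near \oo, a k < lim (a @ \oo) / c.
  by apply: cvgr_lt acvg _ _; rewrite ltr_pdivlMr // gtr_pMr.
have [k Nk ak] := aio N; have := NP k Nk.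
by rewrite ltr_pdivlMr // mulrC ltNge (le_trans (la _) ak).
Qed.

Lemma coord_le_norm (m : nat) (v : 'rV[R]_m) j : `|v 0 j| <= `|v|.
Proof.
rewrite [leRHS]/Num.Def.normr/= mx_normrE.
exact: (le_bigmax _ (fun ij : 'I_1 * 'I_m => `|v ij.1 ij.2|) (0, j)).
Qed.

Lemma norm_le_coord (m : nat) (v : 'rV[R]_m) (M : R) :
  0 <= M -> (forall j, `|v 0 j| <= M) -> `|v| <= M.
Proof.
move=> M0 vM; rewrite [leLHS]/Num.Def.normr/= mx_normrE.
by apply: bigmax_le => // -[i j] _; rewrite (ord1 i).
Qed.

Lemma cvg_coord (T : Type) (F : set_system T) {FF : Filter F} (m n : nat)
    (u : T -> 'M[R]_(m, n)) (p : 'M[R]_(m, n)) i j :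
  u @ F --> p -> (fun t => u t i j) @ F --> p i j.
Proof.
move=> up; apply: (@cvg_comp _ _ _ u (fun M : 'M[R]_(m, n) => M i j) _ _ _ up).
exact: coord_continuous.
Qed.

(** Bolzano-Weierstrass: the norm on pairs is a maximum norm, so the values stay in a product of
    compact boxes. *)
Lemma bounded_pair_subseq (m l : nat) (u : nat -> 'rV[R]_m * 'rV[R]_l) (C : R) :
  (forall N, `|u N| <= C) ->
  exists (s : nat -> nat) (p : 'rV[R]_m * 'rV[R]_l),
    (forall N, (N <= s N)%N) /\ u \o s @ \oo --> p.
Proof.
move=> uC.
have cI k : compact [set v : 'rV[R]_k | forall i, `[- C, C]%classic (v 0 i)].
  by apply: (@rV_compact _ _ (fun=> `[- C, C]%classic)) => i; exact: segment_compact.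
apply: (compact_subseq (compact_setX (cI m) (cI l))) => N.
have [u1C u2C] : `|(u N).1| <= C /\ `|(u N).2| <= C.
  by apply/andP; rewrite -ge_max -prod_normE.
by split=> i /=; rewrite in_itv /= -ler_norml (le_trans (coord_le_norm _ _)).
Qed.

Lemma unbounded_subseq (W : normedModType R) (u : nat -> W) (K : set nat) :
  ~ bounded_set [set u k | k in K] ->
  exists s : nat -> nat, forall N, [/\ (N <= s N)%N, K (s N) & N%:R < `|u (s N)|].
Proof.
move=> unb; suff /choice[s sP] (N : nat) :
    exists k, [/\ (N <= k)%N, K k & N%:R < `|u k|] by exists s.
(* This bound dominates [N] and every norm with index below [N], so an index whose norm exceeds it
   is at least [N]. *)
pose M := N%:R + \sum_(i < N) `|u i|.
have [k Kk Mk] : exists2 k, K k & M < `|u k|.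
  apply: contra_notP unb => nex; exists M; split; first exact: num_real.
  move=> B MB _ [k Kk <-] /=; rewrite leNgt; apply/negP => Bk.
  by apply: nex; exists k => //; exact: lt_trans Bk.
exists k; split => //; last by apply: le_lt_trans Mk; rewrite lerDl sumr_ge0.
rewrite leqNgt; apply/negP => kN; move: Mk; rewrite ltNge /M => /negP; apply.
by rewrite (bigD1 (Ordinal kN)) //= addrCA lerDl addr_ge0 // sumr_ge0.
Qed.

Lemma cvgryM (T : Type) (F : set_system T) {FF : Filter F} (a b : T -> R) (c : R) :
  0 < c -> a @ F --> +oo -> b @ F --> c -> (fun t => a t * b t) @ F --> +oo.
Proof.
move=> c0 /cvgryPge ay bc; apply/cvgryPge => A; near=> t.
(* Eventually [b] exceeds [c / 2], so [a] beyond 2|A|/c brings the product above |A|. *)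
have bt : c / 2 < b t.
  by near: t; apply: (cvgr_gt c) => //; rewrite ltr_pdivrMr // mulr_natr mulr2n ltrDl.
have at_ : `|A| * (2 / c) <= a t by near: t; exact: ay.
have : `|A| * (2 / c) * (c / 2) <= a t * b t.
  by apply: ler_pM at_ (ltW bt); rewrite ?mulr_ge0 ?invr_ge0 ?(ltW c0).
have -> : `|A| * (2 / c) * (c / 2) = `|A| by field; rewrite gt_eqF.
exact: le_trans (ler_norm A).
Unshelve. all: by end_near. Qed.

Lemma cvg_jacT_mul (n m : nat) (G : 'rV[R]_n -> 'rV[R]_m) (T : Type) (F : set_system T)
    {FF : Filter F} (X : T -> 'rV[R]_n) (xbar : 'rV[R]_n)
    (v : T -> 'rV[R]_m) (vbar : 'rV[R]_m) i :
  {for xbar, continuous (jacobian G)} -> X @ F --> xbar -> v @ F --> vbar ->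
  (fun t => jacT_mul G (X t) (v t) 0 i) @ F --> jacT_mul G xbar vbar 0 i.
Proof.
move=> Jc Xx vv.
have -> : (fun t => jacT_mul G (X t) (v t) 0 i) =
    (fun t => \sum_j v t 0 j * 'J G (X t) i j) by apply/funext => t; exact: jacT_mulE.
rewrite (jacT_mulE G xbar vbar i).
apply: cvg_big => [|j _]; first exact: add_continuous.
have JX : (fun t => 'J G (X t)) @ F --> 'J G xbar.
  by apply: (@cvg_comp _ _ _ X (jacobian G) _ _ _ Xx); exact: Jc.
by apply: cvgM; apply: cvg_coord.
Qed.

End Reals.

(** * Penalty parameters and multiplier estimates of the algorithm *)

Section Algorithm.
Context {R : realType} {n m l : nat}.
Context (g : 'rV[R]_n -> 'rV[R]_m) (h : 'rV[R]_n -> 'rV[R]_l).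
Context (upsilon0 : R) (Yg : set 'rV[R]_m) (Yh : set 'rV[R]_l) (tau gamma eta : R).
Context (data : esal_data upsilon0 Yg Yh tau gamma eta).
Context (upsilon rho : nat -> R) (muhat : nat -> 'rV[R]_m) (lamhat : nat -> 'rV[R]_l).
Context (x : nat -> 'rV[R]_n) (z : nat -> 'rV[R]_m) (V : nat -> R).
Context (mu : nat -> 'rV[R]_m) (lam : nat -> 'rV[R]_l).
Context (generated : esal_sequence g h upsilon0 Yg Yh tau gamma eta
                 upsilon rho muhat lamhat x z V mu lam).

Lemma eta_gt0_lt1 : 0 < eta < 1.
Proof.
have /andP[g0 g1] := esal_gamma data; have /andP[ge es] := esal_eta data.
by rewrite (lt_trans g0 ge) (lt_le_trans es) // -sqrtr1 ler_sqrt // ltW.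
Qed.

Lemma esal_step k :
  (upsilon k.+1 = upsilon k /\ rho k.+1 = rho k) \/
  (upsilon k.+1 = gamma * upsilon k /\ rho k.+1 = eta * rho k / gamma).
Proof. by have := esal_update generated k; case: ifP => _; [left|right]. Qed.

Lemma upsilon_gt0 k : 0 < upsilon k.
Proof.
have /andP[g0 _] := esal_gamma data.
elim: k => [|k ih]; first by rewrite (esal_upsilon_init generated) (esal_upsilon0_gt0 data).
by case: (esal_step k) => -[-> _] //; rewrite mulr_gt0.
Qed.

Lemma rho_gt0 k : 0 < rho k.
Proof.
have /andP[g0 _] := esal_gamma data; have /andP[e0 _] := eta_gt0_lt1.
elim: k => [|k ih]; first by rewrite (esal_rho_init generated).
by case: (esal_step k) => -[_ ->] //; rewrite divr_gt0 // mulr_gt0.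
Qed.

Lemma V_ge0 k : 0 <= V k.
Proof. by rewrite (esal_V generated) le_max sqrtr_ge0. Qed.

Lemma penalty_dichotomy :
  (V @ \oo --> (0 : R) /\
     exists N, forall k, (N <= k)%N -> upsilon k = upsilon N /\ rho k = rho N) \/
  (upsilon @ \oo --> (0 : R) /\ (fun k => upsilon k * rho k) @ \oo --> (0 : R)).
Proof.
have gammaP := esal_gamma data; have /andP[g0 g1] := gammaP.
have etaP := eta_gt0_lt1; have /andP[e0 e1] := etaP.
pose ok k := ((V k)%:E <= tau%:E * prev_V V k)%E.
have upd k : if ok k then upsilon k.+1 = upsilon k /\ rho k.+1 = rho k
    else upsilon k.+1 = gamma * upsilon k /\ rho k.+1 = eta * rho k / gamma.
  exact: esal_update generated k.
have [[N okN]|nok] := pselect (exists N, forall k, (N <= k)%N -> ok k).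
  left; split; last first.
    exists N => k /subnK <-; elim: (k - N)%N => [|i [u1 r1]] //.
    by have := upd (i + N)%N; rewrite okN ?leq_addl // u1 r1.
  (* At index [k.+1] the previous value is the finite [V k], so the test is an inequality between
     reals; +oo occurs only at index 0. *)
  have Vdec k : (N <= k)%N -> V k.+1 <= tau * V k.
    by move=> Nk; have := okN k.+1 (leqW Nk); rewrite /ok /= -EFinM lee_fin.
  have tauP := esal_tau data; have /andP[t0 t1] := tauP.
  rewrite -(cvg_shiftn N); apply: (nonincreasing_contracting_cvg0 tauP) => [k|k|M].
  - exact: V_ge0.
  - by rewrite /= addSn (le_trans (Vdec _ (leq_addl _ _))) // ler_piMl ?V_ge0 // ltW //.
  - by exists M => //; rewrite /= addSn Vdec // leq_addl.
have bad N : exists2 k, (N <= k)%N & ~~ ok k.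
  apply: contra_notP nok => nb; exists N => k Nk; apply: contra_notT nb => nk.
  by exists k.
(* On a failure the factor [gamma] of [upsilon] cancels the denominator in the growth of [rho],
   leaving [eta] for the product. *)
have badk k : ~~ ok k ->
    upsilon k.+1 = gamma * upsilon k /\ upsilon k.+1 * rho k.+1 = eta * (upsilon k * rho k).
  move=> nk; have := upd k; rewrite (negbTE nk) => -[-> ->]; split=> //.
  by field; rewrite gt_eqF.
have step k : upsilon k.+1 <= upsilon k /\ upsilon k.+1 * rho k.+1 <= upsilon k * rho k.
  have u0 := upsilon_gt0 k; have ur0 := mulr_gt0 u0 (rho_gt0 k).
  case okk : (ok k); first by have := upd k; rewrite okk => -[-> ->].
  have [-> ->] := badk k (negbT okk).
  by split; apply: ler_piMl; exact: ltW.
right; split.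
  apply: (nonincreasing_contracting_cvg0 gammaP) => [k|k|N].
  - exact/ltW/upsilon_gt0.
  - exact: (step k).1.
  - by have [k Nk /badk[E _]] := bad N; exists k; rewrite ?E.
apply: (nonincreasing_contracting_cvg0 etaP) => [k|k|N].
- by rewrite mulr_ge0 // ltW ?upsilon_gt0 ?rho_gt0.
- exact: (step k).2.
- by have [k Nk /badk[_ E]] := bad N; exists k; rewrite ?E.
Qed.

Lemma scaled_compact_bound (p : nat) (Y : set 'rV[R]_p) (vhat : nat -> 'rV[R]_p) :
  compact Y -> (forall k, [set rho k *: y | y in Y] (vhat k)) ->
  exists2 C : R, 0 < C & forall k i, `|vhat k 0 i| <= C * rho k.
Proof.
move=> /compact_bounded/pinfty_ex_gt0[C C0 YC] vY; exists C => // k i.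
have [y Yy <-] := vY k; rewrite mxE normrM (gtr0_norm (rho_gt0 k)) mulrC.
by rewrite ler_pM2r ?rho_gt0 // (le_trans (coord_le_norm _ _)) //; exact: YC.
Qed.

Lemma scaled_hat_cvg0 (p : nat) (Y : set 'rV[R]_p) (vhat : nat -> 'rV[R]_p) i :
  compact Y -> (forall k, [set rho k *: y | y in Y] (vhat k)) ->
  (fun k => upsilon k * rho k) @ \oo --> (0 : R) ->
  (fun k => upsilon k * vhat k 0 i) @ \oo --> (0 : R).
Proof.
move=> cY vY ur0; have [C C0 vC] := scaled_compact_bound cY vY.
apply: norm_cvg0; apply: (@squeeze_cvgr _ _ _ _ (cst 0) (fun k => C * (upsilon k * rho k))).
- apply: nearW => k; rewrite normr_ge0 /= normrM (gtr0_norm (upsilon_gt0 k)) mulrCA.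
  by rewrite ler_pM2l ?upsilon_gt0.
- exact: cvg_cst.
- by rewrite -(mulr0 C); exact: cvgM (cvg_cst C) ur0.
Qed.

Lemma muhat_cvg0 i : (fun k => upsilon k * rho k) @ \oo --> (0 : R) ->
  (fun k => upsilon k * muhat k 0 i) @ \oo --> (0 : R).
Proof. exact: scaled_hat_cvg0 (esal_Yg_compact data) (esal_muhat generated). Qed.

Lemma lamhat_cvg0 j : (fun k => upsilon k * rho k) @ \oo --> (0 : R) ->
  (fun k => upsilon k * lamhat k 0 j) @ \oo --> (0 : R).
Proof. exact: scaled_hat_cvg0 (esal_Yh_compact data) (esal_lamhat generated). Qed.

(** Subtracting from a number its negative part [Num.min 0] leaves its positive part. *)
Lemma mu_max0 k : mu k = (upsilon k)^-1 *: max0 (g (x k) + upsilon k *: muhat k).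
Proof.
rewrite (esal_mu generated) (esal_z generated); apply/rowP => i.
rewrite !mxE; have := upsilon_gt0 k; move: (g _ 0 i) (muhat k 0 i) (upsilon k) => a b u u0.
have -> : Num.max 0 (a + u * b) = a + u * b - Num.min 0 (a + u * b).
  by case: (leP 0 (a + u * b)); rewrite ?subr0 ?subrr.
by field; rewrite gt_eqF.
Qed.

Lemma lam_scaled k : lam k = (upsilon k)^-1 *: (h (x k) + upsilon k *: lamhat k).
Proof.
rewrite (esal_lam generated) scalerDr scalerA mulVf ?scale1r 1?addrC //.
by rewrite gt_eqF // upsilon_gt0.
Qed.

Lemma mu_ge0 k i : 0 <= mu k 0 i.
Proof.
rewrite mu_max0 !mxE mulr_ge0 ?invr_ge0 ?(ltW (upsilon_gt0 k)) //.
by rewrite le_max lexx.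
Qed.

Lemma mu_eq0 k i : g (x k) 0 i + upsilon k * muhat k 0 i <= 0 -> mu k 0 i = 0.
Proof. by move=> gle; rewrite mu_max0 !mxE; move/max_l: gle => ->; rewrite mulr0. Qed.

(** The update rule solved for the residual: in the regime of vanishing penalty parameters,
    convergent multipliers then force the residual to 0. *)
Lemma residualE k i :
  (g (x k) - z k) 0 i = upsilon k * mu k 0 i - upsilon k * muhat k 0 i.
Proof.
rewrite (esal_mu generated) !mxE; field.
by rewrite gt_eqF // upsilon_gt0.
Qed.

Lemma infeasE k j : h (x k) 0 j = upsilon k * lam k 0 j - upsilon k * lamhat k 0 j.
Proof.
rewrite (esal_lam generated) !mxE; field.
by rewrite gt_eqF // upsilon_gt0.
Qed.

Lemma residual_le_V k i : `|(g (x k) - z k) 0 i| <= V k.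
Proof. by rewrite (esal_V generated) le_max coord_le_enorm. Qed.

Lemma infeas_le_V k j : `|h (x k) 0 j| <= V k.
Proof. by rewrite (esal_V generated) le_max coord_le_enorm orbT. Qed.

Lemma z_le0 k i : z k 0 i <= 0.
Proof. by rewrite (esal_z generated) mxE ge_min lexx. Qed.

Lemma mu_gt0_z0 k i : 0 < mu k 0 i -> z k 0 i = 0.
Proof.
move=> mu0; rewrite (esal_z generated) !mxE; apply/min_l.
by rewrite leNgt; apply/negP => /ltW /mu_eq0 E; rewrite E ltxx in mu0.
Qed.

(** Either [V] dominates the residuals and tends to 0, or each residual is [upsilon] times a
    convergent multiplier minus [upsilon] times its safeguarded estimate, both vanishing. *)
Lemma residual_cvg0 (s : nat -> nat) (mubar : 'rV[R]_m) (lambar : 'rV[R]_l) :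
  s @ \oo --> \oo -> mu \o s @ \oo --> mubar -> lam \o s @ \oo --> lambar ->
  (forall i, (fun N => (g (x (s N)) - z (s N)) 0 i) @ \oo --> (0 : R)) /\
  (forall j, (fun N => h (x (s N)) 0 j) @ \oo --> (0 : R)).
Proof.
move=> soo mus lams; case: penalty_dichotomy => [[V0 _]|[u0 ur0]].
  have Vs : (fun N => V (s N)) @ \oo --> (0 : R) := cvg_comp s _ soo V0.
  split=> i; apply: norm_cvg0;
    apply: (@squeeze_cvgr _ _ _ _ (cst 0) (fun N => V (s N))) => //;
    do ?exact: cvg_cst; apply: nearW => N; rewrite normr_ge0 /=.
    exact: residual_le_V.
  exact: infeas_le_V.
have us : (fun N => upsilon (s N)) @ \oo --> (0 : R) := cvg_comp s _ soo u0.
split=> i.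
  under eq_fun do rewrite residualE.
  rewrite -(subr0 0) -{1}(mul0r (mubar 0 i)); apply: cvgB.
    by apply: cvgM; [exact: us | exact: (cvg_coord (i := 0) (j := i) mus)].
  exact (cvg_comp _ _ soo (muhat_cvg0 i ur0)).
under eq_fun do rewrite infeasE.
rewrite -(subr0 0) -{1}(mul0r (lambar 0 i)); apply: cvgB.
  by apply: cvgM; [exact: us | exact: (cvg_coord (i := 0) (j := i) lams)].
exact (cvg_comp _ _ soo (lamhat_cvg0 i ur0)).
Qed.

Lemma unbounded_multipliers_cvg0 (s : nat -> nat) :
  s @ \oo --> \oo -> (forall N, N%:R < `|(mu (s N), lam (s N))|) ->
  upsilon @ \oo --> (0 : R) /\ (fun k => upsilon k * rho k) @ \oo --> (0 : R).
Proof.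
move=> soo large; case: penalty_dichotomy => // -[V0 [N0 const]]; exfalso.
have [B B0 VB] : exists2 B : R, 0 < B & forall k, `|V k| <= B.
  have /cvg_seq_bounded/pinfty_ex_gt0[B B0 VB] : cvgn V by apply/cvg_ex; exists 0.
  by exists B => // k; exact: VB.
have [C C0 muC] := scaled_compact_bound (esal_Yg_compact data) (esal_muhat generated).
have [D D0 lamD] := scaled_compact_bound (esal_Yh_compact data) (esal_lamhat generated).
have u0 := upsilon_gt0 N0; have r0 := rho_gt0 N0.
(* With frozen parameters, the first term bounds both safeguarded estimates and the second bounds
   the corrections, which are residuals of size at most [B] over [upsilon N0]. *)
pose M := (C + D) * rho N0 + (upsilon N0)^-1 * B.
have M0 : 0 <= M by rewrite addr_ge0 ?mulr_ge0 ?invr_ge0 ?addr_ge0 // ltW.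
have bound k : (N0 <= k)%N -> `|(mu k, lam k)| <= M.
  move=> /const[uk rk]; rewrite prod_normE /= ge_max.
  have aux (a b c E : R) : `|a| <= E * rho k -> E <= C + D -> `|b| <= V k ->
      `|a + (upsilon k)^-1 * b| <= M.
    move=> aE ECD bV; rewrite (le_trans (ler_normD _ _)) // /M lerD //.
      by rewrite (le_trans aE) // rk ler_pM2r.
    rewrite normrM normfV uk (gtr0_norm u0) ler_pM2l ?invr_gt0 //.
    by rewrite (le_trans bV) // (le_trans (ler_norm _)).
  apply/andP; split; apply: norm_le_coord => // i.
    rewrite (esal_mu generated) 2!mxE.
    by apply: (aux _ _ 0 C (muC k i)); rewrite ?lerDl ?(ltW D0) // residual_le_V.
  rewrite (esal_lam generated) 2!mxE.
  by apply: (aux _ _ 0 D (lamD k i)); rewrite ?lerDr ?(ltW C0) // infeas_le_V.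
have [N [sN NM]] : exists N, (N0 <= s N)%N /\ M <= N%:R.
  have sN : \forall N \near \oo, (N0 <= s N)%N by exact (soo _ (nbhs_infty_ge N0)).
  by near \oo => N; exists N; split; near: N; [exact: sN | exact: nbhs_infty_ger].
by have := lt_le_trans (large N) (bound _ sN); rewrite ltNge NM.
Unshelve. all: by end_near. Qed.

(** * Stationarity of limits with convergent multipliers *)

Context (f : 'rV[R]_n -> R) (f_C1 : C1_fun f) (g_C1 : C1_map g) (h_C1 : C1_map h).
Context (eps : nat -> R) (eps_null : eps @ \oo --> (0 : R)).
Context (x_approx : forall k,
  enorm (grad (fun y => aug_lagrangian f g h (upsilon k) y (muhat k) (lamhat k)) (x k))
    <= eps k).

(** The expanded form shared by the Lagrangian gradient at the updated multipliers and the augmented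
    one at the safeguarded estimates. *)
Definition lagrangian_grad k : 'rV[R]_n :=
  grad f (x k) + jacT_mul g (x k) (mu k) + jacT_mul h (x k) (lam k).

Lemma lagrangian_grad_cvg0 i : (fun k => lagrangian_grad k 0 i) @ \oo --> (0 : R).
Proof.
apply: norm_cvg0; apply: (@squeeze_cvgr _ _ _ _ (cst 0) eps) => //.
  apply: nearW => k; rewrite normr_ge0 /=; apply: le_trans (x_approx k).
  rewrite grad_aug_lagrangian ?upsilon_gt0 -?mu_max0 -?lam_scaled ?coord_le_enorm //.
  - exact: f_C1.1.
  - exact: g_C1.1.
  - exact: h_C1.1.
exact: cvg_cst.
Qed.

Lemma cvg_constraint (p : nat) (G : 'rV[R]_n -> 'rV[R]_p) (X : nat -> 'rV[R]_n)
    (xbar : 'rV[R]_n) i :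
  C1_map G -> X @ \oo --> xbar -> (fun N => G (X N) 0 i) @ \oo --> G xbar 0 i.
Proof.
move=> [dG _] Xx; apply: cvg_coord; apply: (@cvg_comp _ _ _ X G _ _ _ Xx).
exact: (differentiable_continuous (dG xbar)).
Qed.

Lemma kkt_limit (s : nat -> nat) (xbar : 'rV[R]_n) (mubar : 'rV[R]_m) (lambar : 'rV[R]_l) :
  s @ \oo --> \oo -> x \o s @ \oo --> xbar ->
  mu \o s @ \oo --> mubar -> lam \o s @ \oo --> lambar ->
  feasible g h xbar /\ certifies_stationarity f g h xbar mubar lambar.
Proof.
move=> soo xs mus lams; have [res0 inf0] := residual_cvg0 soo mus lams.
have gs i : (fun N => g (x (s N)) 0 i) @ \oo --> g xbar 0 i := cvg_constraint (i := i) g_C1 xs.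
have g_le0 i : g xbar 0 i <= 0.
  (* As the residual vanishes, [g xbar] is also the limit of the nonpositive [z]. *)
  have zs : (fun N => z (s N) 0 i) @ \oo --> g xbar 0 i.
    have -> : (fun N => z (s N) 0 i) =
        (fun N => g (x (s N)) 0 i - (g (x (s N)) - z (s N)) 0 i).
      by apply/funext => N; rewrite !mxE; ring.
    by rewrite -[g xbar 0 i]subr0; apply: cvgB.
  by apply: (cvgr_to_le zs); apply: nearW => N; exact: z_le0.
have mu_ge i : 0 <= mubar 0 i.
  by apply: (cvgr_to_ge (cvg_coord (i := 0) (j := i) mus)); apply: nearW => N; exact: mu_ge0.
split; first split=> //.
  apply/rowP => j; rewrite mxE.
  exact: (cvg_unique (@Rhausdorff R) (cvg_constraint (i := j) h_C1 xs) (inf0 j)).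
split=> //.
  rewrite grad_lagrangian; [|exact: f_C1.1|exact: g_C1.1|exact: h_C1.1].
  apply/rowP => i; rewrite [RHS]mxE.
  have grad0 : (fun N => lagrangian_grad (s N) 0 i) @ \oo --> (0 : R).
    exact (cvg_comp _ _ soo (lagrangian_grad_cvg0 i)).
  apply: (cvg_unique (@Rhausdorff R) _ grad0).
  have -> : (fun N => lagrangian_grad (s N) 0 i) =
      (fun N => grad f (x (s N)) 0 i + jacT_mul g (x (s N)) (mu (s N)) 0 i
                + jacT_mul h (x (s N)) (lam (s N)) 0 i).
    by apply/funext => N; rewrite mxE [X in X + _]mxE.
  rewrite mxE [X in X + _]mxE; apply: cvgD; first apply: cvgD.
  - apply: cvg_coord; apply: (@cvg_comp _ _ _ _ (grad f) _ _ _ xs).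
    exact: f_C1.2.
  - exact: cvg_jacT_mul (g_C1.2 xbar) xs mus.
  - exact: cvg_jacT_mul (h_C1.2 xbar) xs lams.
apply: big1 => i _; have := g_le0 i; rewrite le_eqVlt => /predU1P[->|gi].
  by rewrite mulr0.
suff -> : mubar 0 i = 0 by rewrite mul0r.
apply/eqP; rewrite eq_le mu_ge andbT.
apply: (cvgr_to_le (cvg_coord (i := 0) (j := i) mus)); near=> N.
(* With [z] zero, the residual equals the constraint value. The former eventually lies above and the
   latter below half of the negative number [g xbar 0 i], which is absurd. *)
rewrite leNgt /=; apply/negP => /mu_gt0_z0 zi.
have : g (x (s N)) 0 i < g xbar 0 i / 2.
  by near: N; apply: (cvgr_lt _ (gs i)); lra.
have : g xbar 0 i / 2 < (g (x (s N)) - z (s N)) 0 i.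
  by near: N; apply: (cvgr_gt _ (res0 i)); lra.
by rewrite !mxE zi subr0 => /lt_trans/[apply]; rewrite ltxx.
Unshelve. all: by end_near. Qed.

(** * Boundedness of the multipliers *)

Context (xbar : 'rV[R]_n) (xbar_esq : extended_strong_quasinormality g h xbar).
Context (K : set nat) (x_cvg : x @ within K \oo --> xbar).
Context (cond : forall L : set nat, infinite_set L -> L `<=` K ->
     (forall i : 'I_m,
        (fun k => mu k 0 i) @ within L \oo --> +oo ->
        exists Li : set nat, [/\ infinite_set Li, Li `<=` K
          & forall k, Li k -> 0 < g (x k) 0 i]) /\
     (forall j : 'I_l,
        (fun k => lam k 0 j) @ within L \oo --> +oo \/
        (fun k => lam k 0 j) @ within L \oo --> -oo ->
        exists Lj : set nat, [/\ infinite_set Lj, Lj `<=` L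
          & forall k, Lj k -> 0 < lam k 0 j * h (x k) 0 j])).

Lemma x_subseq (P : set nat) : P `<=` K -> (forall N, exists2 k, (N <= k)%N & P k) ->
  exists r : nat -> nat, (forall N, P (r N)) /\ x \o r @ \oo --> xbar.
Proof.
move=> PK Pinf; have /choice[r rP] N : exists k, (N <= k)%N /\ P k.
  by have [k Nk Pk] := Pinf N; exists k.
exists r; split=> [N|]; first exact: (rP N).2.
have rK N : (N <= r N)%N /\ K (r N) by have [Nr /PK] := rP N.
exact: (@cvg_comp _ _ _ r x _ _ _ (cvg_subseq rK) x_cvg).
Qed.

(** The limit direction [p] is shown to be a pair excluded by extended strong quasinormality. *)
Lemma no_unbounded_direction (s : nat -> nat) (p : 'rV[R]_m * 'rV[R]_l) :
  (forall N, (N <= s N)%N /\ K (s N)) ->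
  (forall N, N%:R < `|(mu (s N), lam (s N))|) ->
  (fun N => `|(mu (s N), lam (s N))|^-1 *: (mu (s N), lam (s N))) @ \oo --> p ->
  False.
Proof.
move=> sK large wp.
have sinf : infinite_set (range s) by apply: infinite_range => N; exact: (sK N).1.
have rangeK : range s `<=` K by move=> _ [N _ <-]; exact: (sK N).2.
have soo : s @ \oo --> \oo.
  exact (cvg_trans (cvg_subseq sK) (cvg_within _)).
have xs : x \o s @ \oo --> xbar.
  exact: (@cvg_comp _ _ _ s x _ _ _ (cvg_subseq sK) x_cvg).
have [u0 ur0] := unbounded_multipliers_cvg0 soo large.
pose t N := `|(mu (s N), lam (s N))|.
have t_gt0 N : 0 < t N by exact: le_lt_trans (large N).
have t_oo : t @ \oo --> +oo.
  apply/cvgryPge => A; near=> N; apply: le_trans (ltW (large N)).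
  by near: N; exact: nbhs_infty_ger.
have tV0 : (fun N => (t N)^-1) @ \oo --> (0 : R).
  by apply/gtr0_cvgV0 => //; exact: nearW.
have w1 : (fun N => (t N)^-1 *: mu (s N)) @ \oo --> p.1.
  by apply: (@cvg_comp _ _ _ _ fst _ _ _ wp); case: (p) => a b; exact: cvg_fst.
have w2 : (fun N => (t N)^-1 *: lam (s N)) @ \oo --> p.2.
  by apply: (@cvg_comp _ _ _ _ snd _ _ _ wp); case: (p) => a b; exact: cvg_snd.
have p_neq0 : p != 0.
  suff : `|p| = 1 by move=> p1; apply: contra_eq_neq p1 => ->; rewrite normr0 eq_sym oner_eq0.
  apply: (cvg_unique (@Rhausdorff R) (cvg_norm wp)).
  rewrite [X in X @ _](_ : _ = cst 1); first exact: cvg_cst.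
  by apply/funext => N /=; rewrite normrZ normfV normr_id mulVf // gt_eqF // t_gt0.
have p1_ge0 i : 0 <= p.1 0 i.
  apply: (cvgr_to_ge (cvg_coord (i := 0) (j := i) w1)); apply: nearW => N.
  by rewrite mxE mulr_ge0 ?invr_ge0 ?mu_ge0 // ltW.
have p1_eq0 i : g xbar 0 i < 0 -> p.1 0 i = 0.
  move=> gi; apply/eqP; rewrite eq_le p1_ge0 andbT.
  apply: (cvgr_to_le (cvg_coord (i := 0) (j := i) w1)); near=> N.
  rewrite mxE mu_eq0 ?mulr0 //.
  (* The constraint value stays below half its negative limit and the vanishing shift below minus
     that half, so their sum is negative and [mu_eq0] applies. *)
  have : g (x (s N)) 0 i < g xbar 0 i / 2.
    by near: N; apply: (cvgr_lt _ (cvg_constraint (i := i) g_C1 xs)); lra.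
  have : upsilon (s N) * muhat (s N) 0 i < - (g xbar 0 i / 2).
    near: N; apply: (cvgr_lt (0 : R)); last by lra.
    exact (cvg_comp _ _ soo (muhat_cvg0 i ur0)).
  lra.
have gradp : jacT_mul g xbar p.1 + jacT_mul h xbar p.2 = 0.
  apply/rowP => i; rewrite mxE [RHS]mxE.
  have grad0 : (fun N => (t N)^-1 * lagrangian_grad (s N) 0 i) @ \oo --> (0 : R).
    rewrite -(mulr0 0); apply: cvgM; first exact: tV0.
    exact (cvg_comp _ _ soo (lagrangian_grad_cvg0 i)).
  (* By linearity in the multipliers, the division by [t] normalizes them; only the objective
     gradient is left with a vanishing factor. *)
  have gradE : (fun N => (t N)^-1 * lagrangian_grad (s N) 0 i) =
      (fun N => (t N)^-1 * grad f (x (s N)) 0 i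
        + jacT_mul g (x (s N)) ((t N)^-1 *: mu (s N)) 0 i
        + jacT_mul h (x (s N)) ((t N)^-1 *: lam (s N)) 0 i).
    apply/funext => N; rewrite mxE [X in _ * (X + _)]mxE !mulrDr /jacT_mul -!scalemxAl.
    by congr (_ + _ + _); rewrite [RHS]mxE.
  have fV0 : (fun N => (t N)^-1 * grad f (x (s N)) 0 i) @ \oo --> (0 : R).
    rewrite -(mul0r (grad f xbar 0 i)); apply: cvgM; first exact: tV0.
    apply: cvg_coord; apply: (@cvg_comp _ _ _ _ (grad f) _ _ _ xs).
    exact: f_C1.2.
  have sum_cvg : (fun N => (t N)^-1 * lagrangian_grad (s N) 0 i) @ \oo -->
      0 + jacT_mul g xbar p.1 0 i + jacT_mul h xbar p.2 0 i.
    rewrite gradE; apply: cvgD; first apply: cvgD fV0 _.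
    - exact: cvg_jacT_mul (g_C1.2 xbar) xs w1.
    - exact: cvg_jacT_mul (h_C1.2 xbar) xs w2.
  by rewrite -[LHS]add0r addrA; apply: (cvg_unique (@Rhausdorff R) sum_cvg grad0).
apply: xbar_esq; exists p.1, p.2; split.
- by move=> p0; move/eqP: p_neq0; apply; rewrite (surjective_pairing p).
- move=> i p1i; have mu_oo : (fun k => mu k 0 i) @ within (range s) \oo --> +oo.
    apply: cvg_within_range; rewrite /comp.
    have -> : (fun N => mu (s N) 0 i) = (fun N => t N * ((t N)^-1 *: mu (s N)) 0 i).
      by apply/funext => N; rewrite mxE; field; rewrite gt_eqF.
    apply: (cvgryM (c := p.1 0 i)) => //; last exact: cvg_coord w1.
    by rewrite lt_neqAle eq_sym p1i p1_ge0.
  have [Li [Linf LiK Lig]] := (cond sinf rangeK).1 i mu_oo.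
  have [r [rL xr]] := x_subseq LiK ((infinite_natP Li).1 Linf).
  by exists (x \o r); split=> // k; exact: Lig.
- move=> j p2j.
  (* Multiplying by [p.2 0 j] treats both signs at once, since the normalized product tends to the
     positive square of [p.2 0 j]. *)
  have plam_oo : (fun k => p.2 0 j * lam k 0 j) @ within (range s) \oo --> +oo.
    apply: cvg_within_range; rewrite /comp.
    have -> : (fun N => p.2 0 j * lam (s N) 0 j) =
        (fun N => t N * (p.2 0 j * ((t N)^-1 *: lam (s N)) 0 j)).
      by apply/funext => N; rewrite mxE; field; rewrite gt_eqF.
    apply: (cvgryM (c := p.2 0 j * p.2 0 j)) => //.
      by rewrite -expr2 exprn_even_gt0.
    by apply: cvgM; [exact: cvg_cst | exact: cvg_coord w2].
  have lam_oo : (fun k => lam k 0 j) @ within (range s) \oo --> +oo \/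
                (fun k => lam k 0 j) @ within (range s) \oo --> -oo.
    have lamE : (fun k => lam k 0 j) = (fun k => p.2 0 j * lam k 0 j * (p.2 0 j)^-1).
      by apply/funext => k; field.
    case: (ltgtP (p.2 0 j) 0) p2j => // pj _; [right|left]; rewrite lamE.
      apply/cvgNry.
      have -> : - (fun k => p.2 0 j * lam k 0 j * (p.2 0 j)^-1) =
          (fun k => p.2 0 j * lam k 0 j * - (p.2 0 j)^-1).
        by apply/funext => k; rewrite mulrN.
      apply: cvgryM plam_oo (cvg_cst _).
      by rewrite oppr_gt0 invr_lt0.
    by apply: cvgryM plam_oo (cvg_cst _); rewrite invr_gt0.
  have [Lj [Linf Ls Ljh]] := (cond sinf rangeK).2 j lam_oo.
  have [M _ MP] : within (range s) \oo [set k | 0 < p.2 0 j * lam k 0 j].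
    by have /cvgryPgt := plam_oo; apply.
  (* Beyond [M] the multiplier has the sign of [p.2 0 j], so the sign condition on [lam] carries
     over to [p.2]. *)
  pose P := [set k | Lj k /\ (M <= k)%N].
  have PK : P `<=` K by move=> k [/Ls/rangeK].
  have [N|r [rP xr]] := x_subseq PK.
    have [k] := (infinite_natP Lj).1 Linf (maxn N M).
    by rewrite geq_max => /andP[Nk Mk] Ljk; exists k.
  exists (x \o r); split=> // k /=; have [Ljr Mr] := rP k.
  have pl : 0 < p.2 0 j * lam (r k) 0 j by apply: MP => //; exact: Ls.
  have lh := Ljh _ Ljr.
  have l0 : lam (r k) 0 j != 0 by apply: contraTneq lh => ->; rewrite mul0r ltxx.
  (* The product contains the positive factor [lam (r k) 0 j ^+ 2], which is then divided out. *)
  have := mulr_gt0 pl lh.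
  rewrite mulrA -[_ * _ * lam _ _ _]mulrA -expr2 mulrAC pmulr_lgt0 //.
  by rewrite exprn_even_gt0.
- split=> //; apply: big1 => i _; rewrite mxE.
  by case: (ltP (g xbar 0 i) 0) => gi; rewrite ?mulr0 // p1_eq0 ?mul0r.
Unshelve. all: by end_near. Qed.

Lemma multipliers_bounded : bounded_set [set (mu k, lam k) | k in K].
Proof.
apply: contrapT => /unbounded_subseq[s sP].
(* The normalized multipliers have norm 1, hence a convergent subsequence; since [N <= r N], passing
   to it preserves the lower bound [N] on the original norms. *)
have [N|r [p [Nr wp]]] := @bounded_pair_subseq R m l
    (fun N => `|(mu (s N), lam (s N))|^-1 *: (mu (s N), lam (s N))) 1.
  rewrite normrZ normfV normr_id mulVf // gt_eqF //.
  by have [_ _] := sP N; exact: le_lt_trans.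
apply: (no_unbounded_direction (s := s \o r) _ _ wp) => N; have [rs Ks large] := sP (r N).
  by split=> //; exact: leq_trans (Nr N) rs.
by apply: le_lt_trans large; rewrite ler_nat.
Qed.

Lemma subseq_limit_kkt (s : nat -> nat) (p : 'rV[R]_m * 'rV[R]_l) :
  (forall N, (N <= s N)%N /\ K (s N)) ->
  (fun N => (mu (s N), lam (s N))) @ \oo --> p ->
  feasible g h xbar /\ certifies_stationarity f g h xbar p.1 p.2.
Proof.
move=> sK sp; apply: (@kkt_limit s).
- exact (cvg_trans (cvg_subseq sK) (cvg_within _)).
- exact: (@cvg_comp _ _ _ s x _ _ _ (cvg_subseq sK) x_cvg).
- by apply: (@cvg_comp _ _ _ _ fst _ _ _ sp); case: (p) => a b; exact: cvg_fst.
- by apply: (@cvg_comp _ _ _ _ snd _ _ _ sp); case: (p) => a b; exact: cvg_snd.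
Qed.

End Algorithm.

Theorem theorem3p12 (R : realType) (n m l : nat)
  (f : 'rV[R]_n -> R) (g : 'rV[R]_n -> 'rV[R]_m) (h : 'rV[R]_n -> 'rV[R]_l)
  (f_C1 : C1_fun f) (g_C1 : C1_map g) (h_C1 : C1_map h)
  (upsilon0 : R) (Yg : set 'rV[R]_m) (Yh : set 'rV[R]_l) (tau gamma eta : R)
  (data : esal_data upsilon0 Yg Yh tau gamma eta)
  (eps : nat -> R) (eps_ge0 : forall k, 0 <= eps k)
  (eps_null : eps @ \oo --> (0 : R))
  (upsilon rho : nat -> R)
  (muhat : nat -> 'rV[R]_m) (lamhat : nat -> 'rV[R]_l)
  (x : nat -> 'rV[R]_n) (z : nat -> 'rV[R]_m) (V : nat -> R)
  (mu : nat -> 'rV[R]_m) (lam : nat -> 'rV[R]_l)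
  (generated : esal_sequence g h upsilon0 Yg Yh tau gamma eta
                 upsilon rho muhat lamhat x z V mu lam)
  (x_approx : forall k,
     enorm (grad (fun y => aug_lagrangian f g h (upsilon k) y (muhat k) (lamhat k))
                 (x k)) <= eps k)
  (xbar : 'rV[R]_n)
  (xbar_acc : cluster (x @ \oo) xbar)
  (xbar_esq : extended_strong_quasinormality g h xbar)
  (K : set nat) (K_inf : infinite_set K)
  (x_cvg : x @ within K \oo --> xbar)
  (cond : forall L : set nat, infinite_set L -> L `<=` K ->
     (forall i : 'I_m,
        (fun k => mu k 0 i) @ within L \oo --> +oo ->
        exists Li : set nat, [/\ infinite_set Li, Li `<=` K
          & forall k, Li k -> 0 < g (x k) 0 i]) /\
     (forall j : 'I_l,
        (fun k => lam k 0 j) @ within L \oo --> +oo \/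
        (fun k => lam k 0 j) @ within L \oo --> -oo ->
        exists Lj : set nat, [/\ infinite_set Lj, Lj `<=` L
          & forall k, Lj k -> 0 < lam k 0 j * h (x k) 0 j])) :
  [/\ bounded_set [set (mu k, lam k) | k in K],
      stationary f g h xbar
    & forall (mubar : 'rV[R]_m) (lambar : 'rV[R]_l),
        cluster ((fun k => (mu k, lam k)) @ within K \oo) (mubar, lambar) ->
        certifies_stationarity f g h xbar mubar lambar].
Proof.
have bnd : bounded_set [set (mu k, lam k) | k in K].
  by apply: (multipliers_bounded data generated f_C1 g_C1 h_C1 eps_null x_approx
               xbar_esq x_cvg cond).
have kkt := subseq_limit_kkt data generated f_C1 g_C1 h_C1 eps_null x_approx x_cvg.
split=> // [|mubar lambar /cluster_subseq[s [sK sp]]]; last by case: (kkt s _ sK sp).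
have [s sK] : exists s : nat -> nat, forall N, (N <= s N)%N /\ K (s N).
  suff /choice[s sK] (N : nat) : exists k, (N <= k)%N /\ K k by exists s.
  by have [k Nk Kk] := (infinite_natP K).1 K_inf N; exists k.
(* Boundedness yields a convergent subsequence of multipliers, whose limit provides the pair
   required for stationarity. *)
have [C _ uC] := pinfty_ex_gt0 bnd.
have [N|r [p [Nr rp]]] := @bounded_pair_subseq R m l (fun N => (mu (s N), lam (s N))) C.
  by apply: uC; exists (s N) => //; exact: (sK N).2.
have [N|feas cert] := kkt (s \o r) p _ rp; last by split=> //; exists p.1, p.2.
by have [rs Ks] := sK (r N); split=> //; exact: leq_trans (Nr N) rs.
Qed.
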